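(* Let $C\subset\mathbb{R}^n$ be a non-empty closed convex set and let $g:\mathbb{R}^n\to\mathbb{R}$ and $f:\mathbb{R}^n\to\mathbb{R}$ be convex functions. Assume that $g$ and $f$ are bounded below, that the set $S_0:=\arg\min_C g$ is nonempty, and that the set $S_1:=\arg\min_{S_0} f$ is nonempty and bounded. Let $\{\varepsilon_k\}_{k\ge 0}$ be a decreasing sequence of positive reals with $\lim_{k\to\infty}\varepsilon_k=0$ and $\sum_{k=0}^\infty\varepsilon_k=+\infty$. Let $\{\lambda_k\}_{k\ge 0}$ be a sequence for which there exist $\underline{\lambda}>0$ and $\overline{\lambda}>0$ with $\underline{\lambda}\le\lambda_k\le\overline{\lambda}$ for all $k$, and let $\{\eta_k\}_{k\ge 0}$ be a nonnegative sequence with $\sum_{k=0}^\infty\eta_k<+\infty$. Let $\{x_k\}_{k\ge 0}$ be any sequence in $C$ generated by the algorithm, i.e. $x_0\in C$ and for every $k\ge 0$ the point $x_{k+1}\in C$ satisfies $$-\frac{x_{k+1}-x_k}{\lambda_k}\in\partial_{\eta_k^1}(g+\varepsilon_k f)(x_{k+1})+N_C^{\eta_k^2}(x_{k+1})$$ for some $\eta_k^1,\eta_k^2\ge 0$ with $\eta_k^1+\eta_k^2\le\eta_k$. Then $$\lim_{k\to\infty}d(x_k,S_1)=0.$$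
   Context: For a convex function $h:\mathbb{R}^n\to\mathbb{R}$, $x\in\mathbb{R}^n$ and $\eta\ge 0$, the $\eta$-subdifferential is $\partial_\eta h(x)=\{v\in\mathbb{R}^n: h(y)\ge h(x)+\langle v,y-x\rangle-\eta\ \ \forall y\in\mathbb{R}^n\}$ (for $\eta=0$ this is the usual subdifferential). For a convex set $C$, $\bar x\in C$ and $\eta\ge 0$, the $\eta$-normal set is $N_C^\eta(\bar x)=\{v\in\mathbb{R}^n:\langle v,x-\bar x\rangle\le\eta\ \ \forall x\in C\}$. The sum of two sets is the Minkowski sum. For a set $A$, $\arg\min_A h$ denotes the set of minimizers of $h$ over $A$, and $d(x,A)=\inf_{y\in A}\|y-x\|$ (Euclidean norm). *)

(* Defs.v *)
From mathcomp Require Import all_boot all_order all_algebra.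
From mathcomp Require Import all_classical all_reals all_analysis.
Import Order.TTheory GRing.Theory Num.Theory numFieldNormedType.Exports.

Set Implicit Arguments.
Unset Strict Implicit.
Unset Printing Implicit Defensive.

Local Open Scope classical_set_scope.
Local Open Scope ring_scope.

Definition dotv (R : realType) (n : nat) (u v : 'rV[R]_n) : R :=
  \sum_(i < n) u 0 i * v 0 i.

(* The library norm `|u| on 'rV[R]_n is the sup norm, hence a separate
   Euclidean norm. *)
Definition enorm (R : realType) (n : nat) (u : 'rV[R]_n) : R :=
  Num.sqrt (dotv u u).

(* [inf] is real-valued, with value 0 when A is empty. *)
Definition edistance (R : realType) (n : nat) (x : 'rV[R]_n)
    (A : set 'rV[R]_n) : R :=
  inf [set enorm (y - x) | y in A].

Definition argmin (R : realType) (T : Type) (A : set T) (h : T -> R) : set T :=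
  [set x | A x /\ forall y, A y -> h x <= h y].

Definition eta_subdiff (R : realType) (n : nat) (eta : R)
    (h : 'rV[R]_n -> R) (x : 'rV[R]_n) : set 'rV[R]_n :=
  [set v | forall y, h x + dotv v (y - x) - eta <= h y].

Definition eta_normal (R : realType) (n : nat) (eta : R)
    (C : set 'rV[R]_n) (x : 'rV[R]_n) : set 'rV[R]_n :=
  [set v | forall y, C y -> dotv v (y - x) <= eta].

Definition minkowski_sum (R : realType) (n : nat) (A B : set 'rV[R]_n) :
    set 'rV[R]_n :=
  [set u + v | u in A & v in B].

(* Main.v *)
(* Write S1 = {x in C | G x <= 0} with G = max (g - min g, f - min f), where the
   minima are those of g on C and of f on the minimizers of g. Since G is convex
   and S1 is bounded, the sublevel sets of G in C are bounded and shrink to S1. The energy g (x k) + eps k * f (x k) decreases up to summable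
   errors, so the steps x (k+1) - x k tend to 0. Split the indices according to
   the sign of f (x (k+1)) - min f. When it is negative, x (k+1) lies in a
   bounded sublevel set of G, and the vanishing steps force g (x (k+1)) to
   min g: the iterate is close to S1. When it is nonnegative, the squared
   distance to every point of S1 increases by at most a summable error. It
   remains to see that the iterates come close to S1 infinitely often: if not,
   the squared distance to a fixed point of S1 would eventually decrease by a
   multiple of eps k at each step, contradicting the divergence of the series. *)
Require Import Defs.
From mathcomp Require Import all_boot all_order all_algebra.
From mathcomp Require Import all_classical all_reals all_analysis.
From mathcomp Require Import ring lra.
Import Order.TTheory GRing.Theory Num.Theory numFieldNormedType.Exports.

Local Open Scope classical_set_scope.
Local Open Scope ring_scope.

Set Implicit Arguments.
Unset Strict Implicit.

(** * Convexity inequalities for functions and sets *)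

Lemma convex_functionT_le (R : realType) (E : lmodType R) (h : E -> R) x y t :
  convex_function setT h -> 0 <= t -> t <= 1 ->
  h (t *: x + (1 - t) *: y) <= t * h x + (1 - t) * h y.
Proof.
move=> ch t0 t1.
by have /= := ch (Itv01 t0 t1) x y (mem_set I) (mem_set I).
Qed.

Lemma convex_set_comb (R : realType) (E : lmodType R) (A : set E) x y t :
  convex_set A -> A x -> A y -> 0 <= t -> t <= 1 ->
  A (t *: x + (1 - t) *: y).
Proof.
move=> cA Ax Ay t0 t1.
by have /= := cA x y (Itv01 t0 t1) (mem_set Ax) (mem_set Ay); rewrite inE.
Qed.

Lemma convex_function_maxB (R : realType) (E : lmodType R) (h1 h2 : E -> R)
    (a b : R) :
  convex_function setT h1 -> convex_function setT h2 ->
  convex_function setT (fun x => Num.max (h1 x - a) (h2 x - b)).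
Proof.
move=> c1 c2 t x y _ _.
have s0 : 0 <= t%:inum by rewrite interval_inference.ge0.
have s1 : t%:inum <= 1 by rewrite interval_inference.le1.
set s := t%:inum in s0 s1.
have H1 := convex_functionT_le x y c1 s0 s1.
have H2 := convex_functionT_le x y c2 s0 s1.
rewrite convRE -/s -[unstable.onem s]/(1 - s).
rewrite -[conv t x y]/(s *: x + (1 - s) *: y).
have {}s1 : 0 <= 1 - s by rewrite subr_ge0.
set Mx := Num.max (h1 x - a) _; set My := Num.max (h1 y - a) _.
have [x1 x2] : h1 x - a <= Mx /\ h2 x - b <= Mx
  by rewrite /Mx !le_max !lexx orbT.
have [y1 y2] : h1 y - a <= My /\ h2 y - b <= My
  by rewrite /My !le_max !lexx orbT.
rewrite ge_max; apply/andP; split.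
  have := ler_wpM2l s0 x1; have := ler_wpM2l s1 y1; nra.
have := ler_wpM2l s0 x2; have := ler_wpM2l s1 y2; nra.
Qed.

(** * Continuity of finite convex functions *)

Lemma entry_le_norm (R : realType) (n : nat) (y : 'rV[R]_n) i :
  `|y 0 i| <= `|y|.
Proof.
rewrite -[leRHS]/(mx_norm y) mx_normrE.
exact: (le_bigmax _ (fun ij : 'I_1 * 'I_n => `|y ij.1 ij.2|) (0, i)).
Qed.

(* The bound is additive in [A], because [x + (A + B) y] is the midpoint of
   [x + A (2 y)] and [x + B (2 y)]; this reduces it to the coordinate axes. *)
Lemma convex_local_upper_bound (R : realType) (n : nat) (h : 'rV[R]_n -> R) x :
  convex_function setT h ->
  exists d K : R, [/\ 0 < d, 0 <= K &
    forall y, `|y| <= d -> h (x + y) <= h x + K * `|y|].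
Proof.
move=> ch.
pose P (A : 'rV[R]_n -> 'rV[R]_n) := (forall c y, A (c *: y) = c *: A y) /\
  exists d K : R, [/\ 0 < d, 0 <= K &
    forall y, `|y| <= d -> h (x + A y) <= h x + K * `|y|].
suff [_ [d [K [d0 K0 H]]]] : P (\sum_i fun y => y 0 i *: delta_mx 0 i).
  exists d, K; split=> // y /H; rewrite fct_sumE.
  by rewrite -row_sum_delta.
elim/big_ind: _.
- split; first by move=> c y /=; rewrite scaler0.
  exists 1, 0; split=> // y _; rewrite addr0 mul0r addr0; exact: lexx.
- move=> A B [hA [d1 [K1 [d10 K10 H1]]]] [hB [d2 [K2 [d20 K20 H2]]]]; split.
    by move=> c y; rewrite !fctE hA hB scalerDr.
  exists (Num.min d1 d2 / 2), (K1 + K2); split.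
  + by rewrite divr_gt0// lt_min d10.
  + exact: addr_ge0.
  move=> y; rewrite ler_pdivlMr// le_min => /andP[yd1 yd2].
  have n2 : `|2 *: y| = `|y| * 2 by rewrite normrZ ger0_norm// mulrC.
  have := H1 (2 *: y); have := H2 (2 *: y).
  rewrite n2 => /(_ yd2) h2 /(_ yd1) h1.
  have -> : x + (A + B) y =
      2^-1 *: (x + A (2 *: y)) + (1 - 2^-1) *: (x + B (2 *: y)).
    rewrite !fctE hA hB !scalerDr !scalerA.
    have -> : (1 - 2^-1) = 2^-1 :> R by lra.
    rewrite mulVf// !scale1r addrACA -scalerDl.
    by rewrite (_ : 2^-1 + 2^-1 = 1 :> R) ?scale1r; last lra.
  apply: le_trans (convex_functionT_le _ _ ch _ _) _ => //.
  - by lra.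
  - by lra.
- move=> i _; split; first by move=> c y; rewrite mxE scalerA.
  set e : 'rV[R]_n := delta_mx 0 i.
  (* Convexity on the segments from [x] to [x + e] and to [x - e]; summing the two slopes covers
     both signs of [y 0 i]. *)
  exists 1, (`|h (x + e) - h x| + `|h (x - e) - h x|); split=> //.
  move=> y y1; have yi := entry_le_norm y i.
  have aux (v : 'rV[R]_n) t : 0 <= t -> t <= `|y| ->
      h (x + t *: v) <= h x + `|h (x + v) - h x| * `|y|.
    move=> t0 ty; have t1 := le_trans ty y1.
    have -> : x + t *: v = t *: (x + v) + (1 - t) *: x.
      by rewrite scalerDr scalerBl scale1r addrAC [t *: x + _]addrC subrK.
    apply: le_trans (convex_functionT_le _ _ ch _ _) _ => //.
    have := ler_norm (h (x + v) - h x); have := normr_ge0 (h (x + v) - h x).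
    nra.
  have := normr_ge0 (h (x + e) - h x); have := normr_ge0 (h (x - e) - h x).
  have := normr_ge0 y.
  case: (ger0P (y 0 i)) yi => yi0 yi ny n1 n2.
    by have := aux e _ yi0 yi; nra.
  have := aux (- e) (- y 0 i); rewrite scaleNr scalerN opprK.
  by rewrite oppr_ge0 => /(_ (ltW yi0) yi); nra.
Qed.

(** The local upper bound gives one half. For the other, [x] is the midpoint of [z] and its
    reflection [x - y], so an upper bound at the reflection becomes a lower bound at [z]. *)
Lemma convex_function_continuous (R : realType) (n : nat)
    (h : 'rV[R]_n -> R) :
  convex_function setT h -> continuous (h : 'rV[R]_n -> R^o).
Proof.
move=> ch x; have [d [K [d0 K0 H]]] := convex_local_upper_bound x ch.
have xF : Filter (nbhs x) by exact: nbhs_filter.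
apply/cvgrPdist_le => e e0.
have r0 : 0 < Num.min d (e / (K + 1)).
  by rewrite lt_min d0 divr_gt0// ltr_wpDl.
apply: filterS (nbhsx_ballx x _ r0) => z.
rewrite -ball_normE /= lt_min => /andP[zd].
rewrite ltr_pdivlMr ?ltr_wpDl// => ze.
pose y := z - x.
have yE : `|x - z| = `|y| by rewrite distrC.
have h1 : h z <= h x + K * `|y|.
  by have := H y; rewrite /y addrCA subrr addr0 -distrC; apply; exact: ltW.
have h2 : h (x - y) <= h x + K * `|y|.
  by have := H (- y); rewrite normrN -yE; apply; exact: ltW.
have xE : x = 2^-1 *: z + (1 - 2^-1) *: (x - y).
  have -> : (1 - 2^-1) = 2^-1 :> R by lra.
  rewrite -scalerDr /y opprB addrCA [z + _]addrC subrK.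
  by rewrite -[x + x]/(x *+ 2) -[x *+ 2]scaler_nat scalerA mulVf ?scale1r.
have h3 : h x <= 2^-1 * h z + (1 - 2^-1) * h (x - y).
  by rewrite [in h x]xE; apply: convex_functionT_le => //; lra.
rewrite yE in ze; have := normr_ge0 y; rewrite ler_norml => ny.
by apply/andP; split; nra.
Qed.

(** * Sublevel sets of convex functions on a closed convex set *)

Lemma compact_gt0_lower_bound (R : realType) (T : topologicalType)
    (h : T -> R) (K : set T) :
  compact K -> continuous (h : T -> R^o) -> (forall x, K x -> 0 < h x) ->
  exists2 m, 0 < m & forall x, K x -> m <= h x.
Proof.
move=> cK ch h0; have [K0|/set0P/negP/negPn/eqP K0] := pselect (K !=set0).
  have [c] := compact_EVT_min K0 cK (continuous_subspaceT ch).
  by rewrite inE => /h0 hc hm; exists (h c) => // x Kx; apply: hm; rewrite inE.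
by exists 1 => // x; rewrite K0.
Qed.

Lemma bounded_setP (R : realType) (V : normedModType R) (A : set V) :
  bounded_set A <-> exists B, forall x, A x -> `|x| <= B.
Proof.
split=> [[M [_ H]]|[B H]]; first by exists (M + 1); apply: H; rewrite ltrDl.
exists B; split=> [|x Bx y Ay]; first exact: num_real.
exact: le_trans (H y Ay) (ltW Bx).
Qed.

Lemma continuous_normB (R : realType) (V : normedModType R) (z : V) :
  continuous (fun x : V => `|x - z| : R^o).
Proof. by move=> x; apply: cvg_norm; apply: cvgB => //; exact: cvg_cst. Qed.

(** On a large sphere around a point [z] of the zero sublevel set, [h] is at least some [m > 0]. By
    convexity [h] grows at least linearly along rays from [z] beyond that sphere. *)
Lemma convex_sublevel_bounded (R : realType) (n : nat) (C : set 'rV[R]_n)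
    (h : 'rV[R]_n -> R) M :
  closed C -> convex_set C -> convex_function setT h ->
  C `&` [set x | h x <= 0] !=set0 -> bounded_set (C `&` [set x | h x <= 0]) ->
  bounded_set (C `&` [set x | h x <= M]).
Proof.
move=> Ccl Cco hco [z [Cz /= hz]] /bounded_setP[r rP].
have ch := convex_function_continuous hco.
(* Points at distance [rho] from [z] have norm at least [|r| + 1], hence lie outside the zero
   sublevel set. *)
pose rho := `|z| + `|r| + 1.
have rho0 : 0 < rho by rewrite /rho ltr_wpDl// addr_ge0.
pose K := C `&` [set x | `|x - z| = rho].
have Kc : compact K.
  apply: bounded_closed_compact.
    apply/bounded_setP; exists (rho + `|z|) => x [_ /= <-].
    by rewrite -{1}(subrK z x) ler_normD.
  apply: closedI => //.
  apply: (@preimage_closed _ _ (fun x : 'rV[R]_n => `|x - z| : R^o) [set rho]).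
    by move=> x _; exact: continuous_normB.
  exact: closed_eq.
have K0 x : K x -> 0 < h x.
  move=> [Cx /= xz]; rewrite ltNge; apply/negP => hx.
  have := rP x (conj Cx hx); have := ler_normB x z; have := ler_norm r.
  by rewrite xz /rho; lra.
have [m m0 mP] := compact_gt0_lower_bound Kc ch K0.
apply/bounded_setP; exists (`|z| + rho + rho * `|M| / m) => x [Cx /= hx].
suff : `|x - z| <= rho + rho * `|M| / m.
  by have := ler_normD (x - z) z; rewrite subrK; lra.
have q0 : 0 <= rho * `|M| / m by rewrite divr_ge0// ?mulr_ge0// ltW.
have [|xz] := lerP `|x - z| rho; first by move=> ?; lra.
have d0 : 0 < `|x - z| by exact: lt_trans xz.
(* The segment from [z] to [x] crosses the sphere at this parameter. *)
pose t := rho / `|x - z|.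
have t0 : 0 <= t by rewrite divr_ge0// ltW.
have t1 : t <= 1 by rewrite ler_pdivrMr// mul1r ltW.
have Ky : K (t *: x + (1 - t) *: z).
  split; first exact: convex_set_comb.
  rewrite /= scalerBl scale1r addrCA addrAC subrr add0r -scalerBr normrZ.
  by rewrite ger0_norm// divfK// gt_eqF.
have := mP _ Ky; have := convex_functionT_le x z hco t0 t1.
have := ler_norm M => nM H1 H2.
have : m <= t * `|M| by nra.
rewrite /t mulrAC ler_pdivlMr// => H.
suff : `|x - z| <= rho * `|M| / m by lra.
by rewrite ler_pdivlMr// mulrC.
Qed.

(** Points of the sublevel set at level 1 that stay [e] away from the zero sublevel set form a
    compact set, on which [h] has a positive lower bound; [d] is taken below it. *)
Lemma convex_sublevel_near (R : realType) (n : nat) (C : set 'rV[R]_n)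
    (h : 'rV[R]_n -> R) e :
  closed C -> convex_set C -> convex_function setT h ->
  C `&` [set x | h x <= 0] !=set0 -> bounded_set (C `&` [set x | h x <= 0]) ->
  0 < e ->
  exists2 d, 0 < d & forall x, C x -> h x <= d ->
    exists2 z, (C `&` [set x | h x <= 0]) z & `|x - z| < e.
Proof.
move=> Ccl Cco hco S0 Sb e0.
set S := C `&` [set x | h x <= 0].
have ch := convex_function_continuous hco.
pose K := C `&` [set x | h x <= 1] `&`
          \bigcap_(z in S) [set x | e <= `|x - z|].
have Kc : compact K.
  apply: bounded_closed_compact.
    have /bounded_setP[B BP] := convex_sublevel_bounded 1 Ccl Cco hco S0 Sb.
    by apply/bounded_setP; exists B => x [/BP].
  apply: closedI; first apply: closedI => //.
    by apply: (@preimage_closed _ _ h [set y | y <= 1]).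
  apply: closed_bigI => z _.
  apply: (@preimage_closed _ _ (fun x : 'rV[R]_n => `|x - z| : R^o)
    [set y | e <= y]).
    by move=> x _; exact: continuous_normB.
  exact: closed_ge.
have K0 x : K x -> 0 < h x.
  move=> [[Cx _] Kx]; rewrite ltNge; apply/negP => hx.
  by have := Kx x (conj Cx hx); rewrite /= subrr normr0 leNgt e0.
have [m m0 mP] := compact_gt0_lower_bound Kc ch K0.
exists (Num.min 1 (m / 2)); first by rewrite lt_min ltr01 divr_gt0.
move=> x Cx; rewrite le_min => /andP[hx1 hxm].
apply: contrapT => no.
suff /mP : K x by lra.
split=> // z Sz /=; rewrite leNgt; apply/negP => xz.
by apply: no; exists z.
Qed.

(** * Real sequences that decrease up to summable errors *)

Lemma cvgn_lt_eventually (R : realType) (u : nat -> R) l e :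
  u @ \oo --> l -> l < e -> exists N, forall k, (N <= k)%N -> u k < e.
Proof.
move=> ul le; have := cvgr_lt l ul e le.
by case=> N _ NP; exists N => k /NP.
Qed.

Lemma le_series (R : realType) (w : nat -> R) :
  (forall k, 0 <= w k) -> {homo series w : m n / (m <= n)%N >-> m <= n}.
Proof. by move=> w0; apply: nondecreasing_series => k _ _; exact: w0. Qed.

Lemma series_le_lim (R : realType) (w : nat -> R) n :
  (forall k, 0 <= w k) -> cvg (series w @ \oo) ->
  series w n <= lim (series w @ \oo).
Proof.
by move=> w0 cw; apply: nondecreasing_cvgn_le => //; exact: le_series.
Qed.

Lemma series_tail_lt (R : realType) (w : nat -> R) e :
  (forall k, 0 <= w k) -> cvg (series w @ \oo) -> 0 < e ->
  exists N, forall m n, (N <= m)%N -> series w n - series w m < e.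
Proof.
move=> w0 cw e0; set l := lim (series w @ \oo).
have [N NP] : exists N, forall k, (N <= k)%N -> l - series w k < e.
  apply: (@cvgn_lt_eventually _ (fun k => l - series w k) 0) => //.
  by rewrite -(subrr l); apply: cvgB => //; exact: cvg_cst.
exists N => m n /NP; have := series_le_lim n w0 cw; rewrite -/l; lra.
Qed.

Lemma quasi_descent_telescope (R : realType) (E a w : nat -> R) n :
  (forall k, E k.+1 + a k <= E k + w k) ->
  E n + series a n <= E 0 + series w n.
Proof.
move=> H; elim: n => [|n IH]; first by rewrite !seriesEnat/= !big_geq.
by rewrite !seriesSr; have := H n; lra.
Qed.

Lemma quasi_descent_bounded (R : realType) (E a w : nat -> R) :
  (forall k, 0 <= a k) -> (forall k, 0 <= w k) -> cvg (series w @ \oo) ->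
  (forall k, E k.+1 + a k <= E k + w k) -> exists B, forall k, E k <= B.
Proof.
move=> a0 w0 cw H; exists (E 0 + lim (series w @ \oo)) => k.
have := quasi_descent_telescope k H; have := series_le_lim k w0 cw.
have : 0 <= series a k by rewrite seriesEnat/= sumr_ge0.
lra.
Qed.

Lemma quasi_descent_cvg0 (R : realType) (E a w : nat -> R) :
  (forall k, 0 <= E k) -> (forall k, 0 <= a k) -> (forall k, 0 <= w k) ->
  cvg (series w @ \oo) ->
  (forall k, E k.+1 + a k <= E k + w k) -> a @ \oo --> 0.
Proof.
move=> E0 a0 w0 cw H; apply: cvg_series_cvg_0.
apply: nondecreasing_is_cvgn; first exact: le_series.
exists (E 0 + lim (series w @ \oo)) => _ [k _ <-].
have := quasi_descent_telescope k H; have := series_le_lim k w0 cw.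
by have := E0 k; lra.
Qed.

(* [P k e] is meant as "the k-th term is e-small". *)
Lemma quasi_decrease_eventually (R : realType) (P : nat -> R -> Prop)
    (J : nat -> Prop) (w : nat -> R) :
  (forall k, 0 <= w k) -> cvg (series w @ \oo) ->
  (forall k e e', e <= e' -> P k e -> P k e') ->
  (forall e, 0 < e -> exists N, forall k, (N <= k)%N -> J k -> P k.+1 e) ->
  (forall k e, ~ J k -> P k e -> P k.+1 (e + w k)) ->
  (forall e N, 0 < e -> exists2 k, (N <= k)%N & P k e) ->
  forall e, 0 < e -> exists N, forall k, (N <= k)%N -> P k e.
Proof.
move=> w0 cw mono PJ PnJ Pinf e e0.
have e2 : 0 < e / 2 by rewrite divr_gt0.
have [N1 N1P] := PJ _ e2; have [N2 N2P] := series_tail_lt w0 cw e2.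
have [k0 + k0P] := Pinf _ (maxn N1 N2) e2.
rewrite geq_max => /andP[Nk1 Nk2]; exists k0 => k k0k.
(* Invariant: [j] is the last index at which the tolerance was reset to [e / 2]; since then only the
   errors [w] have been added, and their tail is below [e / 2]. *)
suff [j k0j Pk] : exists2 j, (k0 <= j)%N &
    P k (e / 2 + (series w k - series w j)).
  by apply: mono Pk; have := N2P j k (leq_trans Nk2 k0j); lra.
rewrite -(subnKC k0k); elim: (k - k0)%N => [|i [j k0j Pk]].
  by exists k0; rewrite // addn0 subrr addr0.
rewrite addnS; have kk := leq_addr i k0.
move: (k0 + i)%N kk Pk => {k0k}{}k kk Pk.
have [Jk|nJk] := pselect (J k).
  exists k.+1; first exact: leqW.
  by rewrite subrr addr0; apply: N1P => //; exact: leq_trans kk.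
exists j => //.
by apply: mono (PnJ _ _ nJk Pk); rewrite seriesSr; lra.
Qed.

(** * The bilevel solution set as a sublevel set of a maximum *)

Lemma argmin_argminE (R : realType) (T : Type) (C : set T) (g f : T -> R) p :
  argmin (argmin C g) f p ->
  argmin (argmin C g) f =
    C `&` [set x | Num.max (g x - g p) (f x - f p) <= 0].
Proof.
move=> [[Cp gp] fp]; apply/seteqP; split=> x /=.
  move=> [[Cx gx] fx]; split=> //; rewrite ge_max !subr_le0.
  by rewrite gx//= fx.
rewrite ge_max !subr_le0 => -[Cx /andP[gx fx]]; split; first split=> //.
  by move=> y Cy; exact: le_trans gx (gp y Cy).
by move=> y Sy; exact: le_trans fx (fp y Sy).
Qed.

(** * Euclidean inner product and inexact proximal steps *)

Lemma dotvv_ge0 (R : realType) (n : nat) (v : 'rV[R]_n) : 0 <= dotv v v.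
Proof. by apply: sumr_ge0 => i _; rewrite -expr2 sqr_ge0. Qed.

Lemma dotvDl (R : realType) (n : nat) (u v w : 'rV[R]_n) :
  dotv (u + v) w = dotv u w + dotv v w.
Proof.
by rewrite /dotv -big_split; apply: eq_bigr => i _; rewrite mxE mulrDl.
Qed.

Lemma dotvZl (R : realType) (n : nat) a (u w : 'rV[R]_n) :
  dotv (a *: u) w = a * dotv u w.
Proof.
by rewrite /dotv mulr_sumr; apply: eq_bigr => i _; rewrite mxE mulrA.
Qed.

Lemma dotvv_le_norm (R : realType) (n : nat) (v : 'rV[R]_n) :
  dotv v v <= n%:R * `|v| ^+ 2.
Proof.
rewrite -[n in n%:R]card_ord mulr_natl -sumr_const.
apply: ler_sum => i _; rewrite -expr2 -real_normK ?num_real//.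
by rewrite lerXn2r ?nnegrE ?normr_ge0// entry_le_norm.
Qed.

Lemma dotv_three_points (R : realType) (n : nat) (a b z : 'rV[R]_n) :
  2 * dotv (a - b) (z - b) =
  dotv (a - b) (a - b) + dotv (z - b) (z - b) - dotv (z - a) (z - a).
Proof.
rewrite /dotv mulr_sumr -big_split/= -sumrB; apply: eq_bigr => i _.
by rewrite !mxE; ring.
Qed.

Lemma dotv_young (R : realType) (n : nat) (u v : 'rV[R]_n) s :
  - (2 * s * dotv u v) <= s ^+ 2 * dotv u u + dotv v v.
Proof.
rewrite -subr_ge0 opprK /dotv !mulr_sumr -!big_split/=.
apply: sumr_ge0 => i _.
by rewrite (_ : _ + _ = (s * u 0 i + v 0 i) ^+ 2) ?sqr_ge0//; ring.
Qed.

(** The inclusion writes [a - b] as [lam *: (u + v)]; pairing with [y - b] adds the approximate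
    subgradient inequality for [u] and the approximate normal inequality for [v]. *)
Lemma prox_step_le (R : realType) (n : nat) (C : set 'rV[R]_n)
    (h : 'rV[R]_n -> R) (a b : 'rV[R]_n) (lam eta1 eta2 : R) y :
  0 < lam ->
  minkowski_sum (eta_subdiff eta1 h b) (eta_normal eta2 C b)
    (- (lam^-1 *: (b - a))) ->
  C y -> dotv (a - b) (y - b) <= lam * (h y - h b + (eta1 + eta2)).
Proof.
move=> lam0 [u /(_ y) hu [v /(_ y) hv uv]] Cy.
have -> : a - b = lam *: (u + v).
  by rewrite uv -scalerN opprB scalerA mulfV ?gt_eqF// scale1r.
rewrite dotvZl dotvDl ler_pM2l//; have := hv Cy; lra.
Qed.

Lemma edistance_le (R : realType) (n : nat) (x z : 'rV[R]_n)
    (A : set 'rV[R]_n) :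
  A z -> 0 <= edistance x A <= enorm (z - x).
Proof.
move=> Az; have lb : lbound [set enorm (y - x) | y in A] 0.
  by move=> _ [y _ <-]; exact: sqrtr_ge0.
have nz : [set enorm (y - x) | y in A] (enorm (z - x)) by exists z.
apply/andP; split; first by apply: lb_le_inf => //; exists (enorm (z - x)).
by apply: ge_inf => //; exists 0.
Qed.

Lemma convex_sublevel_enear (R : realType) (n : nat) (C : set 'rV[R]_n)
    (h : 'rV[R]_n -> R) e :
  closed C -> convex_set C -> convex_function setT h ->
  C `&` [set x | h x <= 0] !=set0 -> bounded_set (C `&` [set x | h x <= 0]) ->
  0 < e ->
  exists2 d, 0 < d & forall x, C x -> h x <= d ->
    exists2 z, (C `&` [set x | h x <= 0]) z & dotv (z - x) (z - x) < e.
Proof.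
move=> Ccl Cco hco S0 Sb e0.
(* Passing from the sup norm to the squared Euclidean norm costs a factor [n]. The bound 1 gives
   [y ^+ 2 <= y], and [n.+1] keeps the quotient meaningful for [n = 0]. *)
pose r := Num.min 1 (e / n.+1%:R).
have r0 : 0 < r by rewrite lt_min ltr01 divr_gt0.
have [d d0 dP] := convex_sublevel_near Ccl Cco hco S0 Sb r0.
exists d => // x Cx hx; have [z Sz xz] := dP x Cx hx; exists z => //.
apply: le_lt_trans (dotvv_le_norm _) _; rewrite distrC.
have : r <= 1 by rewrite ge_min lexx.
have : r * n.+1%:R <= e by rewrite -ler_pdivlMr// ge_min lexx orbT.
move: (normr_ge0 (x - z)) xz; set y := `|x - z| => y0 yr rn r1.
have nyr : n%:R * y <= n%:R * r by rewrite ler_wpM2l// ltW.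
apply: (@le_lt_trans _ _ (n%:R * y)); last by rewrite -natr1 in rn; lra.
by rewrite ler_wpM2l// expr2 ler_piMr// (le_trans (ltW yr)).
Qed.

(* Prox inequality at a minimizer [p]: by Young, the inner product with the
   vanishing step [a - b] is small, which forces [g b] close to [g p]. *)
Lemma small_step_near_min (R : realType) (n : nat) (a b p : 'rV[R]_n)
    (lam lmin d Q s r : R) :
  0 < lmin -> lmin <= lam -> 0 < d -> dotv (p - b) (p - b) <= Q -> 0 <= Q ->
  s = 2 * (Q + 1) / (lmin * d) ->
  dotv (a - b) (a - b) < lmin * d / (2 * s) ->
  dotv (a - b) (p - b) <= lam * (d / 2 - r) -> r <= d.
Proof.
move=> lmin0 lminl d0 pQ Q0 sE ab H.
have ld0 : 0 < lmin * d by exact: mulr_gt0.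
have s0 : 0 < s by rewrite sE divr_gt0// mulr_gt0// ltr_wpDl.
have sld : s * (lmin * d) = 2 * (Q + 1) by rewrite sE divfK// gt_eqF.
rewrite ltr_pdivlMr ?mulr_gt0// in ab.
have := dotv_young (a - b) (p - b) s.
set A := dotv (a - b) (a - b) in ab *; set B := dotv _ _ in H *.
set D := dotv _ _ in pQ * => Y.
(* By the choice of [s], [D] is at most [s * (lmin * d) / 2]. Dividing by [s] and using the bound on
   [A] yields [B > - (lmin * d / 2)], which [r > d] would violate. *)
have Y2 : 0 <= s * (2 * B + s * A + lmin * d / 2).
  have -> : s * (2 * B + s * A + lmin * d / 2) =
      2 * s * B + s ^+ 2 * A + s * (lmin * d) / 2 by field.
  by rewrite sld; lra.
rewrite pmulr_rge0// in Y2.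
rewrite leNgt; apply/negP => rd.
have : lam * (d / 2 - r) < lmin * (- (d / 2)).
  apply: (@lt_le_trans _ _ (lam * - (d / 2))).
    by rewrite ltr_pM2l ?(lt_le_trans lmin0)//; lra.
  by rewrite !mulrN lerN2 ler_wpM2r//; lra.
lra.
Qed.

(** * Convergence of the iterates *)

Unset Implicit Arguments.
Set Strict Implicit.

Theorem theorem2p1 (R : realType) (n : nat)
    (C : set 'rV[R]_n) (g f : 'rV[R]_n -> R)
    (eps lambda eta : nat -> R) (x : nat -> 'rV[R]_n)
    (C_nonempty : C !=set0) (C_closed : closed C) (C_convex : convex_set C)
    (g_convex : convex_function setT g) (f_convex : convex_function setT f)
    (g_bounded_below : has_lbound (range g))
    (f_bounded_below : has_lbound (range f))
    (S0_nonempty : argmin C g !=set0)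
    (S1_nonempty : argmin (argmin C g) f !=set0)
    (S1_bounded : bounded_set (argmin (argmin C g) f))
    (eps_gt0 : forall k, 0 < eps k)
    (eps_decreasing : nonincreasing_seq eps)
    (eps_to0 : eps @ \oo --> (0 : R))
    (eps_diverges : series eps @ \oo --> +oo)
    (lambda_bounds : exists lmin lmax : R,
       [/\ 0 < lmin, 0 < lmax & forall k, lmin <= lambda k <= lmax])
    (eta_ge0 : forall k, 0 <= eta k)
    (eta_summable : cvg (series eta @ \oo))
    (x0_in_C : C (x 0%N))
    (x_step : forall k, C (x k.+1) /\
       exists eta1 eta2 : R,
         [/\ 0 <= eta1, 0 <= eta2, eta1 + eta2 <= eta k &
             minkowski_sum
               (eta_subdiff eta1 (fun y => g y + eps k * f y) (x k.+1))
               (eta_normal eta2 C (x k.+1))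
               (- ((lambda k)^-1 *: (x k.+1 - x k)))]) :
  (fun k => edistance (x k) (argmin (argmin C g) f)) @ \oo --> (0 : R).
Proof.
have [p pS1] := S1_nonempty.
have [[Cp gp] fp] := pS1.
have S1E := argmin_argminE pS1.
set S1 := argmin (argmin C g) f in S1_nonempty S1_bounded pS1 S1E *.
pose G y := Num.max (g y - g p) (f y - f p).
have Gco : convex_function setT G by exact: convex_function_maxB.
have [lmin [lmax [lmin0 lmax0 lamP]]] := lambda_bounds.
have lam0 k : 0 < lambda k by have /andP[+ _] := lamP k; exact: lt_le_trans.
have Cx k : C (x k) by case: k => [//|k]; have [] := x_step k.
have [a aP] := g_bounded_below; have [b bP] := f_bounded_below.
have ga y : a <= g y by apply: aP; exists y.
have fb y : b <= f y by apply: bP; exists y.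
pose D k z := dotv (z - x k) (z - x k).
pose A k := dotv (x k - x k.+1) (x k - x k.+1).
(* Used with [y = x k] for the energy descent and with [y] in [S1] for the distances. *)
have prox k y : C y -> dotv (x k - x k.+1) (y - x k.+1) <=
    lambda k * (g y + eps k * f y - (g (x k.+1) + eps k * f (x k.+1)) + eta k).
  move=> Cy; have [_ [eta1 [eta2 [_ _ le_eta step]]]] := x_step k.
  apply: le_trans (prox_step_le (lam0 k) step Cy) _ => /=.
  by rewrite ler_pM2l//; lra.
have dist_step k y : C y -> D k.+1 y <= D k y + 2 * (lambda k *
    (g y + eps k * f y - (g (x k.+1) + eps k * f (x k.+1)) + eta k)).
  move=> Cy; have := prox k y Cy; have := dotv_three_points (x k) (x k.+1) y.
  by rewrite /D; have := dotvv_ge0 (x k - x k.+1); lra.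
(* Shifting by the lower bounds makes the energy nonnegative, and lets [eps k] be replaced by the
   smaller [eps k.+1] without increasing it. *)
pose E k := g (x k) - a + eps k * (f (x k) - b).
have E0 k : 0 <= E k.
  by rewrite addr_ge0 ?mulr_ge0 ?subr_ge0// ltW.
have descent k : E k.+1 + A k / lmax <= E k + eta k.
  have A0 : 0 <= A k by exact: dotvv_ge0.
  have /andP[_ lamk] := lamP k.
  have Al : A k / lmax <= A k / lambda k.
    by rewrite ler_wpM2l// lef_pV2 ?posrE.
  have : A k / lambda k <= E k -
      (g (x k.+1) - a + eps k * (f (x k.+1) - b)) + eta k.
    by rewrite ler_pdivrMr// mulrC; have := prox k _ (Cx k); rewrite /A /E; lra.
  have : eps k.+1 * (f (x k.+1) - b) <= eps k * (f (x k.+1) - b).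
    by rewrite ler_wpM2r ?subr_ge0//; exact: eps_decreasing.
  by rewrite {2}/E; lra.
have Al0 k : 0 <= A k / lmax by rewrite divr_ge0// ?dotvv_ge0// ltW.
have [B EB] := quasi_descent_bounded Al0 eta_ge0 eta_summable descent.
have Acvg := quasi_descent_cvg0 E0 Al0 eta_ge0 eta_summable descent.
have A_small e : 0 < e -> exists N, forall k, (N <= k)%N -> A k < e.
  move=> e0; have el : 0 < e / lmax by rewrite divr_gt0.
  have [N NP] := cvgn_lt_eventually Acvg el; exists N => k /NP.
  by rewrite ltr_pM2r// invr_gt0.
have eta_cvg : eta @ \oo --> 0 by exact: cvg_series_cvg_0.
have eps_small e : 0 < e -> exists N, forall k, (N <= k)%N -> eps k < e.
  exact: cvgn_lt_eventually eps_to0.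
(* Here [e] bounds a squared distance; an explicit [z] is kept because the same point serves from
   one step to the next in [P_step]. *)
pose P k e := exists2 z, S1 z & D k z < e.
have near_S1 e : 0 < e -> exists2 d, 0 < d &
    forall k, G (x k) <= d -> P k e.
  move=> e0; rewrite /P S1E.
  have [||d d0 dP] := convex_sublevel_enear C_closed C_convex Gco _ _ e0.
  - by rewrite -[_ `&` _]S1E.
  - by rewrite -[_ `&` _]S1E.
  by exists d => // k; exact: dP.
pose w k := 2 * lmax * eta k.
have w0 k : 0 <= w k by rewrite !mulr_ge0// ltW.
have w_summable : cvg (series w @ \oo).
  exact: (@is_cvg_seriesZ R eta (2 * lmax) eta_summable).
have lam_eta k : 2 * (lambda k * eta k) <= w k.
  by rewrite /w -mulrA ler_pM2l// ler_wpM2r//; have /andP[] := lamP k.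
have P_step k e : ~ f (x k.+1) < f p -> P k e -> P k.+1 (e + w k).
  move=> /negP; rewrite -leNgt => fx [z Sz Dz]; exists z => //.
  have [[Cz gz] fz] := Sz.
  have : 2 * (lambda k * (g z + eps k * f z -
      (g (x k.+1) + eps k * f (x k.+1)) + eta k)) <= 2 * (lambda k * eta k).
    rewrite ler_pM2l// ler_pM2l//.
    have := gz _ (Cx k.+1).
    have : eps k * f z <= eps k * f (x k.+1).
      by rewrite ler_pM2l// (le_trans _ fx)// fz//; have [] := pS1.
    lra.
  by have := dist_step k z Cz; have := lam_eta k; lra.
(* Below the level [f p] the iterates stay in a bounded sublevel set of [G],
   so the vanishing steps force [g (x k)] to its minimum. *)
have P_below e : 0 < e ->
    exists N, forall k, (N <= k)%N -> f (x k.+1) < f p -> P k.+1 e.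
  move=> e0; have [d d0 dP] := near_S1 e e0.
  (* The energy bound gives [g (x k) - g p <= B + a - g p] for all [k]. The absolute value makes the
     level nonnegative, so it also dominates the negative [f (x k.+1) - f p]. *)
  have [||B' B'P] := (bounded_setP _).1
    (@convex_sublevel_bounded _ _ C G `|B + a - g p| C_closed C_convex Gco _ _).
  - by rewrite -[_ `&` _]S1E.
  - by rewrite -[_ `&` _]S1E.
  pose Q := n%:R * (`|p| + B') ^+ 2.
  pose s := 2 * (Q + 1) / (lmin * d).
  have Q0 : 0 <= Q by rewrite mulr_ge0// sqr_ge0.
  have ld0 : 0 < lmin * d by exact: mulr_gt0.
  have s0 : 0 < s by rewrite divr_gt0// mulr_gt0// ltr_wpDl.
  have [N1 N1P] : exists N, forall k, (N <= k)%N -> A k < lmin * d / (2 * s).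
    by apply: A_small; rewrite divr_gt0// mulr_gt0.
  (* The [eps] term and the [eta] term get [d / 4] each, the total [d / 2] allowed by
     [small_step_near_min]; the added 1 covers the case [f p = b]. *)
  have fpb0 : 0 < f p - b + 1 by rewrite ltr_wpDl// subr_ge0.
  have [N2 N2P] : exists N, forall k, (N <= k)%N ->
      eps k < d / 4 / (f p - b + 1).
    by apply: eps_small; rewrite !divr_gt0.
  have [N3 N3P] : exists N, forall k, (N <= k)%N -> eta k < d / 4.
    by apply: cvgn_lt_eventually eta_cvg _; rewrite divr_gt0.
  exists (maxn N1 (maxn N2 N3)) => k; rewrite !geq_max => /and3P[k1 k2 k3] fx.
  apply: dP; rewrite ge_max; apply/andP; split; last by lra.
  have nx : `|x k.+1| <= B'.
    apply: B'P; split=> //=; rewrite ge_max; apply/andP; split; last first.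
      by have := normr_ge0 (B + a - g p); lra.
    have : 0 <= eps k.+1 * (f (x k.+1) - b).
      by rewrite mulr_ge0 ?subr_ge0// ltW.
    by have := EB k.+1; have := ler_norm (B + a - g p); rewrite /E; lra.
  have pQ : dotv (p - x k.+1) (p - x k.+1) <= Q.
    apply: le_trans (dotvv_le_norm _) _; rewrite ler_wpM2l//.
    rewrite lerXn2r ?nnegrE ?addr_ge0// ?(le_trans _ nx)//.
    by apply: le_trans (ler_normB _ _) _; rewrite lerD2l.
  have /andP[lk _] := lamP k.
  apply: (small_step_near_min lmin0 lk d0 pQ Q0 erefl (N1P k k1)).
  apply: le_trans (prox k p Cp) _; rewrite ler_pM2l//.
  have := N3P k k3; have := N2P k k2; rewrite ltr_pdivlMr// => e1 e2.
  have : eps k * f p - eps k * f (x k.+1) <= eps k * (f p - b + 1).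
    by rewrite -mulrBr ler_pM2l//; have := fb (x k.+1); lra.
  lra.
(* Otherwise every step would decrease the squared distance to [p] by a
   multiple of [eps k], up to a summable error. *)
have P_inf e N : 0 < e -> exists2 k, (N <= k)%N & P k e.
  move=> e0; apply: contrapT => noP.
  have nP k : (N <= k)%N -> ~ P k e by move=> Nk Pk; apply: noP; exists k.
  have [d d0 dP] := near_S1 e e0; have [N1 N1P] := P_below e e0.
  have [N2 N2P] := eps_small 1 ltr01.
  pose M := maxn N (maxn N1 N2).
  have decr k : (M <= k)%N ->
      D k.+1 p + 2 * lmin * d * eps k <= D k p + w k.
    rewrite !geq_max => /and3P[k0 k1 k2].
    have nPk : ~ P k.+1 e by apply: nP; exact: leqW.
    have fx : f p <= f (x k.+1).
      by rewrite leNgt; apply/negP => fx; apply: nPk; exact: N1P.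
    have gx := gp _ (Cx k.+1).
    have eps1 : eps k <= 1 by rewrite ltW// N2P.
    have epsf : 0 <= eps k * (f (x k.+1) - f p).
      by rewrite mulr_ge0 ?subr_ge0// ltW.
    (* Being far from [S1] means [G > d], so one of the two gaps exceeds [d]; [eps k <= 1] handles
       the gap in [g]. *)
    have gap : d * eps k <= g (x k.+1) - g p + eps k * (f (x k.+1) - f p).
      have : ~~ (G (x k.+1) <= d) by apply/negP => /dP.
      rewrite -ltNge lt_max => /orP[gd|fd].
        have : d * eps k <= d by rewrite ler_piMr// ltW.
        lra.
      have : d * eps k <= eps k * (f (x k.+1) - f p).
        by rewrite mulrC ler_pM2l// ltW.
      lra.
    have gap2 : lmin * (d * eps k) <= lambda k *
        (g (x k.+1) - g p + eps k * (f (x k.+1) - f p)).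
      have /andP[lk _] := lamP k.
      by apply: ler_pM => //; [exact: ltW|rewrite mulr_ge0// ltW].
    have := dist_step k p Cp; have := lam_eta k; lra.
  have tele m : D (M + m)%N p +
      2 * lmin * d * (series eps (M + m)%N - series eps M) <=
      D M p + (series w (M + m)%N - series w M).
    elim: m => [|m IH]; first by rewrite addn0 !subrr mulr0.
    by rewrite addnS !seriesSr; have := decr (M + m)%N (leq_addr _ _); lra.
  have c0 : 0 < 2 * lmin * d by rewrite !mulr_gt0.
  (* Once the partial sums of [eps] reach [T], the telescoped decrease would force
     [D (M + N') p <= -1]. *)
  pose T := series eps M + (D M p + lim (series w @ \oo) + 1) / (2 * lmin * d).
  have /cvgryPge /(_ T) [N' _ N'P] := eps_diverges.
  have := N'P (M + N')%N (leq_addl _ _); rewrite /T /= -lerBrDl ler_pdivrMr//.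
  have := tele N'; have := series_le_lim (M + N') w0 w_summable.
  have : 0 <= series w M by rewrite seriesEnat/= sumr_ge0.
  have := dotvv_ge0 (p - x (M + N')%N); rewrite -/(D _ _); lra.
have P_all : forall e, 0 < e -> exists N, forall k, (N <= k)%N -> P k e.
  apply: (quasi_decrease_eventually w0 w_summable _ P_below P_step P_inf).
  by move=> k e e' ee' [z Sz Dz]; exists z => //; exact: lt_le_trans ee'.
apply/cvgrPdist_lt => e e0.
have [N NP] := P_all (e ^+ 2) (exprn_gt0 _ e0).
exists N => // k /= /NP[z Sz Dz].
have /andP[d0 dz] := edistance_le (x k) Sz.
rewrite sub0r normrN ger0_norm//; apply: le_lt_trans dz _.
by rewrite -(gtr0_norm e0) -sqrtr_sqr ltr_sqrt// exprn_gt0.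
Qed.
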